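(* Fix $\beta\ge0$ and let $f:\mathbb{R}^n\to\mathbb{R}$ be a $(-\beta n)$-log-subharmonic function such that $\int_{\mathbb{R}^n}f\,d\gamma=1$, where $\gamma$ is the standard Gaussian measure on $\mathbb{R}^n$. Then $$f(x)\le(\beta+1)^{\frac n2}e^{\frac{|x|^2}{2}} .$$
   Context: A (nonnegative) function $f:\mathbb{R}^n\to\mathbb{R}$ is $cn$-log-subharmonic, for $c\in\mathbb{R}$, if $x\mapsto\log f(x)-c\frac{|x|^2}{2}$ is subharmonic. Thus $f$ is $(-\beta n)$-log-subharmonic if $x\mapsto\log f(x)+\beta\frac{|x|^2}{2}$ is subharmonic. *)

(* Defs.v *)
From HB Require Import structures.
From mathcomp Require Import all_boot all_order all_algebra.
From mathcomp Require Import all_classical all_reals all_analysis.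

Set Implicit Arguments.
Unset Strict Implicit.
Unset Printing Implicit Defensive.
Import Order.TTheory GRing.Theory Num.Theory.
Import numFieldNormedType.Exports.

Local Open Scope classical_set_scope.
Local Open Scope ring_scope.

(* R^n is 'rV[R]_n. It has the library's topology, which is that of the sup
   norm, and hence the Euclidean one; but the library's norm and balls on
   'rV[R]_n are those of the sup norm, hence the two definitions below. *)

Definition enorm (R : realType) (n : nat) (x : 'rV[R]_n) : R :=
  Num.sqrt (\sum_(i < n) x 0 i ^+ 2).

Definition eball (R : realType) (n : nat) (x : 'rV[R]_n) (r : R) :
  set 'rV[R]_n := [set y | enorm (y - x) < r].

(* The Borel sigma-algebra of R^n, as the one generated by the coordinates. *)

Section measurable_rV.
Variables (R : realType) (n : nat).

Let coors (i : 'I_n) (x : 'rV[R]_n) : measurableTypeR R := x 0 i.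

Let rV_set0 : g_sigma_preimage coors set0.
Proof. exact: sigma_algebra0. Qed.

Let rV_setC A : g_sigma_preimage coors A -> g_sigma_preimage coors (~` A).
Proof. exact: sigma_algebraC. Qed.

Let rV_bigcup (F : (set 'rV[R]_n)^nat) :
  (forall i, g_sigma_preimage coors (F i)) ->
  g_sigma_preimage coors (\bigcup_i (F i)).
Proof. exact: sigma_algebra_bigcup. Qed.

HB.instance Definition _ :=
  @isMeasurable.Build (measure_tuple_display (R.-ocitv.-measurable).-sigma)
    'rV[R]_n (g_sigma_preimage coors) rV_set0 rV_setC rV_bigcup.

End measurable_rV.

Lemma measurable_fun_rVP (R : realType) d (T : measurableType d) (n : nat)
    (f : T -> 'rV[R]_n) :
  measurable_fun [set: T] f <->
  forall i, measurable_fun [set: T]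
    (fun x => f x 0 i : measurableTypeR R).
Proof.
pose c i (v : 'rV[R]_n) : measurableTypeR R := v 0 i.
apply: (@iff_trans _ (g_sigma_preimage (fun i => c i \o f) `<=` measurable)).
  rewrite g_sigma_preimage_comp; split=> [mf A [/= C preC <-]|prefS].
    exact: mf.
  by move=> _ A mA; apply: prefS; exists A.
split=> [fS i|mf].
- move=> _ A mA; apply: fS; apply: sub_sigma_algebra.
  rewrite -bigcup_seq/=; exists i => /=; first by rewrite mem_index_enum.
  by exists A.
- apply: smallest_sub; first exact: sigma_algebra_measurable.
  rewrite -bigcup_seq/=; apply: bigcup_sub => i _.
  by move=> A [B mB <-]; exact: mf.
Qed.

(* (a, (x_1, ..., x_n)) |-> (a, x_1, ..., x_n) *)
Definition rV_cons (R : realType) (n : nat)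
    (p : measurableTypeR R * 'rV[R]_n) : 'rV[R]_n.+1 :=
  \row_(i < n.+1) oapp (fun j => p.2 0 j) p.1 (unlift ord0 i).

Lemma measurable_rV_cons (R : realType) (n : nat) :
  measurable_fun [set: measurableTypeR R * 'rV[R]_n] (@rV_cons R n).
Proof.
apply/measurable_fun_rVP => i.
case: (unliftP ord0 i) => [j|] -> {i}.
  have /measurable_fun_rVP/(_ j) :=
    @measurable_snd _ _ (measurableTypeR R) 'rV[R]_n.
  by apply: eq_measurable_fun => p _; rewrite mxE liftK.
apply: (eq_measurable_fun fst) => // p _.
by rewrite mxE unlift_none.
Qed.

Section product_measure_rV_step.
Variables (R : realType) (n : nat).
Variable mu : {sigma_finite_measure set (measurableTypeR R) -> \bar R}.
Variable nu : {sigma_finite_measure set 'rV[R]_n -> \bar R}.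

Definition rV_cons_measure : set 'rV[R]_n.+1 -> \bar R :=
  pushforward (mu \x nu)%E (@rV_cons R n).

Let rV_cons_measure0 : rV_cons_measure set0 = 0%E.
Proof. by rewrite /rV_cons_measure /pushforward preimage_set0 measure0. Qed.

Let rV_cons_measure_ge0 A : (0 <= rV_cons_measure A)%E.
Proof. exact: (measure_ge0 (mu \x nu)%E). Qed.

Let measurable_rV_cons_preimage A :
  measurable A -> measurable (@rV_cons R n @^-1` A).
Proof.
by move=> mA; rewrite -[X in measurable X]setTI; exact: measurable_rV_cons.
Qed.

Let rV_cons_measure_sigma_additive : semi_sigma_additive rV_cons_measure.
Proof.
move=> F mF tF mUF; rewrite /rV_cons_measure /pushforward preimage_bigcup.
apply: measure_semi_sigma_additive.
- by move=> k; exact: measurable_rV_cons_preimage.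
- apply/trivIsetP => /= i j _ _ ij; rewrite -preimage_setI.
  by move/trivIsetP : tF => /(_ _ _ _ _ ij) ->//; rewrite preimage_set0.
- by rewrite -preimage_bigcup; exact: measurable_rV_cons_preimage.
Qed.

HB.instance Definition _ := isMeasure.Build _ _ _ rV_cons_measure
  rV_cons_measure0 rV_cons_measure_ge0 rV_cons_measure_sigma_additive.

Let rV_cons_measure_sigma_finite : sigma_finite setT rV_cons_measure.
Proof.
have /sigma_finiteP[F [TF ndF Foo]] := sigma_finiteT mu.
have /sigma_finiteP[G [TG ndG Goo]] := sigma_finiteT nu.
pose hd (x : 'rV[R]_n.+1) : measurableTypeR R := x 0 ord0.
pose tl (x : 'rV[R]_n.+1) : 'rV[R]_n := \row_j x 0 (lift ord0 j).
have mhd : measurable_fun setT hd.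
  by have /measurable_fun_rVP/(_ ord0) := @measurable_id _ 'rV[R]_n.+1 setT.
have mtl : measurable_fun setT tl.
  apply/measurable_fun_rVP => j.
  have /measurable_fun_rVP/(_ (lift ord0 j)) :=
    @measurable_id _ 'rV[R]_n.+1 setT.
  by apply: eq_measurable_fun => x _; rewrite mxE.
exists (fun k => hd @^-1` F k `&` tl @^-1` G k) => [|k].
  rewrite predeqE => x; split=> // _.
  have [i _ Fi] : (\bigcup_i F i) (hd x) by rewrite -TF.
  have [j _ Gj] : (\bigcup_i G i) (tl x) by rewrite -TG.
  exists (maxn i j) => //; split.
  - by apply: (subsetPset _ _ (ndF i (maxn i j) (leq_maxl i j))) Fi.
  - by apply: (subsetPset _ _ (ndG j (maxn i j) (leq_maxr i j))) Gj.
have [mFk Fkoo] := Foo k; have [mGk Gkoo] := Goo k; split.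
  by apply: measurableI; rewrite -[X in measurable X]setTI; [exact: mhd|exact: mtl].
rewrite /rV_cons_measure /pushforward.
rewrite (_ : _ @^-1` _ = F k `*` G k).
  by rewrite product_measure1E// lte_mul_pinfty// ge0_fin_numE.
apply/seteqP; split=> -[a x]; rewrite /= /hd mxE unlift_none/=;
  (suff -> : tl (rV_cons (a, x)) = x by []);
  by apply/rowP => j; rewrite !mxE liftK.
Qed.

HB.instance Definition _ := Measure_isSigmaFinite.Build _ _ _ rV_cons_measure
  rV_cons_measure_sigma_finite.

End product_measure_rV_step.

(* The n-fold product mu x ... x mu. *)
Fixpoint product_measure_rV (R : realType)
    (mu : {sigma_finite_measure set (measurableTypeR R) -> \bar R}) (n : nat) :
    {sigma_finite_measure set 'rV[R]_n -> \bar R} :=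
  match n with
  | 0%N => @dirac _ 'rV[R]_0 (0 : 'rV[R]_0) R
  | m.+1 => rV_cons_measure mu (product_measure_rV mu m)
  end.

Definition lebesgue_rV (R : realType) (n : nat) :
    {sigma_finite_measure set 'rV[R]_n -> \bar R} :=
  product_measure_rV lebesgue_measure n.

Definition gaussian_rV (R : realType) (n : nat) :
    {sigma_finite_measure set 'rV[R]_n -> \bar R} :=
  product_measure_rV (normal_prob 0 1) n.

Definition upper_semicontinuous (X : topologicalType) (R : realType)
    (u : X -> \bar R) : Prop :=
  lower_semicontinuous (fun x => - u x)%E.

(* The sub-mean value property is over solid balls. The integral is well defined
   in [-oo, +oo[, since the first two conditions bound u above on balls. The
   constant -oo is not excluded. *)
Definition subharmonic (R : realType) (n : nat) (u : 'rV[R]_n -> \bar R) :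
    Prop :=
  [/\ forall x, (u x < +oo)%E,
      upper_semicontinuous u &
      forall (x : 'rV[R]_n) (r : R), 0 < r ->
        (u x <= ((fine (lebesgue_rV R n (eball x r)))^-1)%:E *
                \int[lebesgue_rV R n]_(y in eball x r) u y)%E].

(* lne is the extended logarithm, with lne 0 = -oo. *)
Definition log_subharmonic (R : realType) (n : nat) (c : R)
    (f : 'rV[R]_n -> R) : Prop :=
  (forall x, 0 <= f x) /\
  subharmonic (fun x => lne (f x)%:E - (c * (enorm x ^+ 2 / 2))%:E)%E.

(* Main.v *)
Require Import Defs.
From mathcomp Require Import all_boot all_order all_algebra.
From mathcomp Require Import all_classical all_reals all_analysis.
From mathcomp Require Import measurable_realfun ring lra.

Set Implicit Arguments.
Unset Strict Implicit.
Unset Printing Implicit Defensive.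
Import Order.TTheory GRing.Theory Num.Theory.
Import numFieldNormedType.Exports.

(** Write [u] for the subharmonic function [log f + beta |y|^2 / 2] and put
    [s = beta + 1], so that [f(y) exp(-|y|^2/2) = exp(u(y) - s |y|^2/2)]. The
    identity [|y|^2 = |x|^2 + 2 <x, y - x> + |y - x|^2] centres the exponent
    at the point [x] where [f] is to be bounded:

      f(y) exp(-|y|^2/2) exp(s |x|^2/2) = h(y) exp(-s |y - x|^2/2)

    where [h(y) = exp(u(y) - s <x, y - x>)]. The function [u - s <x, . - x>]
    is again subharmonic and takes the value [u(x)] at [x], because the linear
    term has mean zero on every ball [B] centred at [x]. By Jensen's
    inequality [exp(u(x)) |B|] is at most the integral of [h] over [B]
    ([exp_subharmonic_tilt]). The superlevel sets of the weight
    [exp(-s |y - x|^2/2)] are balls centred at [x], so integrating this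
    inequality over the levels of the weight ([layer_cake_le]) gives

      exp(u(x)) int exp(-s |y - x|^2/2) dy
        <= exp(s |x|^2/2) int f(y) exp(-|y|^2/2) dy.

    The integral on the left is [(2 pi / s)^(n/2)] ([integral_gaussian_rV]),
    the one on the right is [(2 pi)^(n/2)] times the integral of [f] with
    respect to the standard Gaussian measure ([gaussian_rV_lebesgue]), hence
    equals [(2 pi)^(n/2)], and [exp(u(x)) = f(x) exp(beta |x|^2/2)].

    The Gaussian integrals, the change from the Gaussian to the Lebesgue
    measure and the invariance of the latter under reflections are reduced to
    the line by induction on [n], with Tonelli's theorem. *)

Local Open Scope classical_set_scope.
Local Open Scope ring_scope.

(** * Borel sets of R^n *)

Section borel_rV.
Variables (R : realType) (n : nat).

Lemma measurable_coord (i : 'I_n) :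
  measurable_fun [set: 'rV[R]_n] (fun x => x 0 i : measurableTypeR R).
Proof. by move: i; apply/measurable_fun_rVP; exact: measurable_id. Qed.

(** An open set is the union of the boxes with rational vertices that it
    contains, and there are countably many of those. *)
Lemma open_measurable_rV (U : set 'rV[R]_n) : open U -> measurable U.
Proof.
move=> oU.
pose box (pq : 'rV[rat]_n * 'rV[rat]_n) : set 'rV[R]_n :=
  [set y | forall i, ratr (pq.1 0 i) < y 0 i < ratr (pq.2 0 i)].
have mbox pq : measurable (box pq).
  rewrite (_ : box pq = \bigcap_(i in [set: 'I_n])
    ((fun x : 'rV[R]_n => x 0 i : measurableTypeR R) @^-1`
      `]ratr (pq.1 0 i), ratr (pq.2 0 i)[%classic)).
    apply: fin_bigcap_measurable => [|i _]; first exact: finite_finset.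
    by rewrite -[X in measurable X]setTI; exact: measurable_coord.
  apply/seteqP; split=> y /= yb i => [_|]; first by rewrite /= in_itv/=.
  by have := yb i Logic.I; rewrite /= in_itv/=.
rewrite (_ : U = \bigcup_pq (if pselect (box pq `<=` U) then box pq else set0)).
  apply: countable_bigcupT_measurable; first exact: countableP.
  by move=> pq; case: pselect => _ /=; [exact: mbox|exact: measurable0].
apply/seteqP; split=> [x Ux|x [pq _]]; last first.
  by case: pselect => [boxU|_ //]; exact: boxU.
have /nbhs_ballP[e/= e0 xeU] : nbhs x U by exact: open_nbhs_nbhs.
have p_ i : {q : rat | x 0 i - e < ratr q < x 0 i}.
  have /rat_in_itvoo/cid[q] : x 0 i - e < x 0 i by rewrite ltrBlDr ltrDl.
  by rewrite in_itv/= => ?; exists q.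
have q_ i : {q : rat | x 0 i < ratr q < x 0 i + e}.
  have /rat_in_itvoo/cid[q] : x 0 i < x 0 i + e by rewrite ltrDl.
  by rewrite in_itv/= => ?; exists q.
exists (\row_i sval (p_ i), \row_i sval (q_ i)) => //.
case: pselect => [boxU|nboxU].
  move=> i /=; rewrite !mxE.
  by move: (svalP (p_ i)) (svalP (q_ i)); lra.
exfalso; apply: nboxU => y ybox; apply: xeU; split=> // j i.
rewrite (ord1 j) /ball/=.
move: (ybox i) (svalP (p_ i)) (svalP (q_ i)); rewrite !mxE/= ltr_norml.
by lra.
Qed.

Lemma upper_semicontinuous_measurable (u : 'rV[R]_n -> \bar R) :
  upper_semicontinuous u -> measurable_fun [set: 'rV[R]_n] u.
Proof.
move=> uscu; rewrite (_ : u = (fun x => - (- u x))%E); last first.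
  by apply/funext => x; rewrite oppeK.
apply: measurableT_comp => //.
apply: (measurability _ (ErealGenOInfty.measurableE R)) => _ [_ [a ->]] <-.
rewrite setTI preimage_itvoy; apply: open_measurable_rV.
by move/lower_semicontinuousP : uscu; exact.
Qed.

End borel_rV.

(** * Integration over product measures *)

Section product_integral.
Variable R : realType.
Implicit Types mu nu : {sigma_finite_measure set (measurableTypeR R) -> \bar R}.
Local Open Scope ereal_scope.

Lemma integral_product_measure_rVS mu n (F : 'rV[R]_n.+1 -> \bar R) :
  measurable_fun [set: 'rV[R]_n.+1] F -> (forall x, 0 <= F x) ->
  \int[product_measure_rV mu n.+1]_x F x =
  \int[mu]_a \int[product_measure_rV mu n]_z F (rV_cons (a, z)).
Proof.
move=> mF F0.
rewrite -(fubini_tonelli1 (F \o @rV_cons R n))//=; last first.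
  by apply: measurableT_comp => //; exact: measurable_rV_cons.
rewrite /= -[LHS]/(\int[pushforward _ _]_x F x).
by rewrite ge0_integral_pushforward//; exact: measurable_rV_cons.
Qed.

Lemma integral_product_measure_rV0 mu (F : 'rV[R]_0 -> \bar R) :
  measurable_fun [set: 'rV[R]_0] F ->
  \int[product_measure_rV mu 0]_x F x = F 0%R.
Proof. by move=> mF; rewrite /= integral_dirac// diracE in_setT mul1e. Qed.

Lemma measurable_comp_rV_cons n (F : 'rV[R]_n.+1 -> \bar R) :
  measurable_fun [set: 'rV[R]_n.+1] F ->
  measurable_fun [set: measurableTypeR R * 'rV[R]_n] (F \o @rV_cons R n).
Proof.
by move=> mF; apply: measurableT_comp => //; exact: measurable_rV_cons.
Qed.

Lemma measurable_rV_cons_slice n (F : 'rV[R]_n.+1 -> \bar R) a :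
  measurable_fun [set: 'rV[R]_n.+1] F ->
  measurable_fun [set: 'rV[R]_n] (fun z => F (rV_cons (a, z))).
Proof.
move=> /measurable_comp_rV_cons mF.
exact: (measurableT_comp mF (pair1_measurable a)).
Qed.

Lemma measurable_integral_rV_cons mu n (F : 'rV[R]_n.+1 -> \bar R) :
  measurable_fun [set: 'rV[R]_n.+1] F -> (forall x, 0 <= F x) ->
  measurable_fun [set: measurableTypeR R]
    (fun a => \int[product_measure_rV mu n]_z F (rV_cons (a, z))).
Proof.
move=> mF F0; apply: (measurable_fun_fubini_tonelli_F (F \o @rV_cons R n)).
- exact: measurable_comp_rV_cons.
- by move=> p; exact: F0.
Qed.

Lemma rV_cons0 n (p : measurableTypeR R * 'rV[R]_n) : rV_cons p 0%R ord0 = p.1.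
Proof. by rewrite mxE unlift_none. Qed.

Lemma rV_consS n (p : measurableTypeR R * 'rV[R]_n) j :
  rV_cons p 0%R (lift ord0 j) = p.2 0%R j.
Proof. by rewrite mxE liftK. Qed.

Lemma measurable_prod_coord n (g : 'I_n -> R -> R) :
  (forall i, measurable_fun [set: measurableTypeR R] (g i)) ->
  measurable_fun [set: 'rV[R]_n] (fun x => (\prod_(i < n) g i (x 0%R i))%:E).
Proof.
move=> mg; apply/measurable_EFinP; apply: measurable_prod => i _.
exact: (measurableT_comp (mg i) (measurable_coord i)).
Qed.

Lemma integral_product_measure_rV_prod mu n (g : 'I_n -> R -> R)
    (c : 'I_n -> R) :
  (forall i, measurable_fun [set: measurableTypeR R] (g i)) ->
  (forall i t, (0 <= g i t)%R) ->
  (forall i, \int[mu]_t (g i t)%:E = (c i)%:E) ->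
  \int[product_measure_rV mu n]_x (\prod_(i < n) g i (x 0%R i))%:E =
  (\prod_(i < n) c i)%:E.
Proof.
elim: n g c => [|n IH] g c mg g0 gc.
  rewrite integral_product_measure_rV0 ?big_ord0//.
  exact: measurable_prod_coord.
rewrite integral_product_measure_rVS; last 2 first.
  exact: measurable_prod_coord.
  by move=> x; rewrite lee_fin prodr_ge0.
transitivity (\int[mu]_a
    ((g ord0 a)%:E * (\prod_(i < n) c (lift ord0 i))%:E)); last first.
  rewrite ge0_integralZr//.
  - by rewrite gc big_ord_recl EFinM.
  - exact/measurable_EFinP.
  - by move=> t _; rewrite lee_fin.
  - rewrite lee_fin prodr_ge0// => i _.
    by rewrite -lee_fin -gc integral_ge0// => t _; rewrite lee_fin.
apply: eq_integral => a _.
rewrite -(IH (fun i => g (lift ord0 i)) (fun i => c (lift ord0 i)))//.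
rewrite -ge0_integralZl_EFin//; last 2 first.
- by move=> z _; rewrite lee_fin prodr_ge0.
- exact: (@measurable_prod_coord n (fun i => g (lift ord0 i))).
apply: eq_integral => z _; rewrite big_ord_recl rV_cons0 EFinM.
by congr (_ * _%:E); apply: eq_bigr => i _; rewrite rV_consS.
Qed.

(** The density relation on the line is stated through integrals so that it
    applies at once to the outer integral in the inductive step. *)
Lemma integral_product_measure_rV_density mu nu n (g : R -> R) :
  measurable_fun [set: measurableTypeR R] g -> (forall t, (0 <= g t)%R) ->
  (forall F : measurableTypeR R -> \bar R, measurable_fun setT F ->
    (forall t, 0 <= F t) -> \int[nu]_t F t = \int[mu]_t ((g t)%:E * F t)) ->
  forall F : 'rV[R]_n -> \bar R, measurable_fun [set: 'rV[R]_n] F ->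
    (forall x, 0 <= F x) ->
  \int[product_measure_rV nu n]_x F x =
  \int[product_measure_rV mu n]_x ((\prod_(i < n) g (x 0%R i))%:E * F x).
Proof.
move=> mg g0 gnu; elim: n => [|n IH] F mF F0.
  rewrite !integral_product_measure_rV0//; last first.
    apply: emeasurable_funM => //.
    exact: (@measurable_prod_coord 0 (fun=> g)).
  by rewrite big_ord0 mul1e.
have mprod k : measurable_fun [set: 'rV[R]_k]
    (fun x => (\prod_(i < k) g (x 0%R i))%:E).
  exact: (@measurable_prod_coord k (fun=> g)).
have mgF k (G : 'rV[R]_k -> \bar R) : measurable_fun [set: 'rV[R]_k] G ->
    measurable_fun [set: 'rV[R]_k]
      (fun x => (\prod_(i < k) g (x 0%R i))%:E * G x).
  by move=> mG; apply: emeasurable_funM => //; exact: mprod.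
have gF0 k (G : 'rV[R]_k -> \bar R) : (forall x, 0 <= G x) ->
    forall x : 'rV[R]_k, 0 <= (\prod_(i < k) g (x 0%R i))%:E * G x.
  by move=> G0 x; rewrite mule_ge0// lee_fin prodr_ge0.
rewrite integral_product_measure_rVS// gnu; last 2 first.
- exact: measurable_integral_rV_cons.
- by move=> a; exact: integral_ge0.
rewrite integral_product_measure_rVS//; last 2 first.
- exact: mgF.
- exact: gF0.
apply: eq_integral => a _.
have mFa := @measurable_rV_cons_slice n F a mF.
rewrite (IH (fun z => F (rV_cons (a, z))))//.
rewrite -ge0_integralZl_EFin//; last 2 first.
- by move=> z _; exact: (gF0 n (fun z => F (rV_cons (a, z)))).
- exact: mgF.
apply: eq_integral => z _.
rewrite muleA -EFinM big_ord_recl rV_cons0; congr (_%:E * _).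
by congr (_ * _)%R; apply: eq_bigr => i _; rewrite rV_consS.
Qed.

(** Coordinatewise maps that preserve the measure on the line preserve the
    product measure; the case of interest is the reflection in a point. *)
Lemma integral_product_measure_rV_map mu n (phi : 'I_n -> R -> R) :
  (forall i, measurable_fun [set: measurableTypeR R] (phi i)) ->
  (forall i (F : measurableTypeR R -> \bar R), measurable_fun setT F ->
    (forall t, 0 <= F t) -> \int[mu]_t F (phi i t) = \int[mu]_t F t) ->
  forall F : 'rV[R]_n -> \bar R, measurable_fun [set: 'rV[R]_n] F ->
    (forall x, 0 <= F x) ->
  \int[product_measure_rV mu n]_x F (\row_i phi i (x 0%R i)) =
  \int[product_measure_rV mu n]_x F x.
Proof.
have mrow k (ph : 'I_k -> R -> R) :
    (forall i, measurable_fun [set: measurableTypeR R] (ph i)) ->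
    measurable_fun [set: 'rV[R]_k] (fun x => \row_i ph i (x 0%R i)).
  move=> mph; apply/measurable_fun_rVP => i.
  under eq_fun do rewrite mxE.
  exact: (measurableT_comp (mph i) (measurable_coord i)).
elim: n phi => [|n IH] phi mphi phimu F mF F0.
  rewrite !integral_product_measure_rV0//; last first.
    exact: (measurableT_comp mF (mrow _ _ mphi)).
  by congr F; apply/rowP; case.
rewrite !integral_product_measure_rVS//; last first.
  exact: (measurableT_comp mF (mrow _ _ mphi)).
rewrite -[RHS](phimu ord0); last 2 first.
- exact: measurable_integral_rV_cons.
- by move=> a; exact: integral_ge0.
apply: eq_integral => a _.
rewrite -[RHS](IH (fun i => phi (lift ord0 i)))//; last 2 first.
- by move=> i; exact: phimu.
- exact: measurable_rV_cons_slice.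
apply: eq_integral => z _; congr F; apply/rowP => i; rewrite !mxE.
by case: unliftP => [j|] -> /=; rewrite ?mxE ?liftK ?unlift_none.
Qed.

End product_integral.

(** * Lebesgue and Gaussian measures on the line *)

Section line.
Variable R : realType.
Local Notation mu := (@lebesgue_measure R).

Lemma measurable_reflection (c : R) :
  measurable_fun [set: measurableTypeR R]
    (fun t : measurableTypeR R => c - t : measurableTypeR R).
Proof. exact: measurable_funB. Qed.

Lemma ge0_integral_reflection (c : R) (F : measurableTypeR R -> \bar R) :
  measurable_fun [set: measurableTypeR R] F -> (forall t, (0 <= F t)%E) ->
  (\int[mu]_t F (c - t)%R = \int[mu]_t F t)%E.
Proof.
move=> mF F0.
pose r (t : measurableTypeR R) : measurableTypeR R := c - t.
have mr : measurable_fun setT r := measurable_reflection c.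
rewrite -[LHS](@ge0_integral_pushforward _ _ _ _ _ _ mr mu setT F)//.
apply: eq_measure_integral => A mA _.
apply/esym/(@lebesgue_measure_unique R (pushforward mu r)) => // _ [[a b]] _ <-.
have rab : r @^-1` `]a, b]%classic = `[c - b, c - a[%classic.
  by apply/seteqP; split=> t /=; rewrite /r !in_itv/=; lra.
rewrite /= /pushforward rab !lebesgue_measure_itv/= !lte_fin ltrD2l ltrN2.
by case: ifPn => // _; rewrite -!EFinD; congr EFin; ring.
Qed.

Local Open Scope ereal_scope.

(** The normal density is almost everywhere the Radon-Nikodym derivative of
    the normal law, because both have the same integral over every set. *)
Lemma integral_normal_prob (m s : R) (F : measurableTypeR R -> \bar R) :
  measurable_fun [set: measurableTypeR R] F -> (forall t, 0 <= F t) ->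
  \int[normal_prob m s]_t F t = \int[mu]_t ((normal_pdf m s t)%:E * F t).
Proof.
move=> mF F0; have nmu := normal_prob_dominates m s.
rewrite -(Radon_Nikodym_SigmaFinite.change_of_variables nmu)//.
apply: ae_eq_integral => //.
- apply: emeasurable_funM => //.
  exact: measurable_int (Radon_Nikodym_SigmaFinite.f_integrable nmu).
- apply: emeasurable_funM => //; apply/measurable_EFinP.
  exact: measurable_normal_pdf.
under [X in ae_eq _ _ _ X]eq_fun do rewrite muleC.
apply: ae_eqe_mul2l.
apply: integral_ae_eq => //.
- exact: Radon_Nikodym_SigmaFinite.f_integrable.
- by apply/measurable_EFinP; exact: measurable_normal_pdf.
- by move=> E _ mE; rewrite -Radon_Nikodym_SigmaFinite.f_integral.
Qed.

(** The integrand is, up to normalization, the density of the normal law with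
    mean [m] and variance [1 / s]. *)
Lemma integral_gaussian (m s : R) : (0 < s)%R ->
  \int[mu]_t (expR (- (s * (t - m) ^+ 2 / 2)))%:E =
  (Num.sqrt (s^-1 * pi *+ 2))%:E.
Proof.
move=> s0; have rs0 : Num.sqrt s^-1 != 0%R.
  by rewrite gt_eqF// sqrtr_gt0 invr_gt0.
have := integral_normal_pdf m (Num.sqrt s^-1); rewrite normal_pdfE//.
rewrite /normal_peak sqr_sqrtr ?invr_ge0 ?ltW//.
set K := Num.sqrt _.
have K0 : (0 < K)%R.
  by rewrite sqrtr_gt0 mulrn_wgt0// mulr_gt0 ?invr_gt0 ?pi_gt0.
under eq_integral do rewrite EFinM.
rewrite ge0_integralZl_EFin//; last 3 first.
- by move=> t _; rewrite lee_fin normal_fun_ge0.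
- by apply/measurable_EFinP; exact: measurable_normal_fun.
- by rewrite invr_ge0 ltW.
have -> : (fun t => (normal_fun m (Num.sqrt s^-1) t)%:E) =
          (fun t => (expR (- (s * (t - m) ^+ 2 / 2)))%:E).
  apply/funext => t; rewrite /normal_fun sqr_sqrtr ?invr_ge0 ?ltW//.
  by congr (expR _)%:E; field; rewrite gt_eqF.
move=> /(congr1 (fun z => K%:E * z)).
by rewrite mule1 muleA -EFinM divff ?gt_eqF// mul1e.
Qed.

End line.

(** * Jensen's inequality and the layer cake formula *)

Section jensen_layer_cake.
Local Open Scope ereal_scope.

Lemma measurable_expeR (R : realType) : measurable_fun [set: \bar R] (@expeR R).
Proof.
apply: (measurability _ (ErealGenOInfty.measurableE R)) => _ [_ [a ->]] <-.
rewrite setTI preimage_itvoy; have [a0|a0] := leP 0%R a; last first.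
  rewrite (_ : [set _ | _] = setT)//; apply/seteqP; split=> // x _ /=.
  by rewrite (lt_le_trans _ (expeR_ge0 x))// lte_fin.
have [y <-] : exists y, expeR y = a%:E by apply: expeR_total; rewrite lee_fin.
under eq_set do rewrite lte_expeR.
rewrite -[X in measurable X]setTI; exact: emeasurable_fun_o_infty.
Qed.

Context d (T : measurableType d) (R : realType).

(** This is the tangent line bound [exp a (1 + v - l - a) <= exp (v - l)], with
    the negative parts of [v], [- l] and [- a] moved to the other side: both
    sides are then sums of nonnegative terms, and can be integrated without
    knowing beforehand that [v] is integrable. *)
Lemma expeR_tangent (a l : R) (v : \bar R) :
  (expR a)%:E * (1 + maxe v 0 + (Num.max (- l) 0)%:E + (Num.max (- a) 0)%:E) <=
  expeR (v - l%:E) +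
    (expR a)%:E * (maxe (- v) 0 + (Num.max l 0)%:E + (Num.max a 0)%:E).
Proof.
case: v => [v| |].
- have posneg (x : R) : x = (Num.max x 0 - Num.max (- x) 0)%R.
    by rewrite !maxEle; do 2 case: ifPn; lra.
  rewrite -!EFinN -!EFin_max -EFinB/= -!(EFinD, EFinM) lee_fin.
  have : (expR a * (1 + (v - l - a)) <= expR (v - l))%R.
    rewrite -[leRHS](_ : expR a * expR (v - l - a) = _)%R; last first.
      by rewrite -expRD; congr expR; ring.
    by rewrite ler_wpM2l ?expR_ge0// expR_ge1Dx.
  rewrite {1}(posneg v) {1}(posneg l) {2}(posneg a).
  by set E := expR a; lra.
- rewrite (_ : maxe (- +oo) 0 = 0); last by apply/max_idPr; rewrite leNye.
  by rewrite add0e [leRHS]addye ?leey// -EFinD -EFinM.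
- rewrite (_ : maxe (- -oo) 0 = +oo); last by apply/max_idPl; rewrite leey.
  by rewrite add0e !addye// gt0_muley ?leey// lte_fin expR_gt0.
Qed.

(** Jensen's inequality for the exponential, for a function [u - L] whose term
    [L] has mean zero. The hypothesis on the integral of [u] bounds its
    negative part only; an infinite positive part makes the right-hand side
    infinite. *)
Lemma expR_mean_le (mu : {measure set T -> \bar R}) (B : set T)
    (u : T -> \bar R) (L : T -> R) (a : R) :
  measurable B -> mu B < +oo -> measurable_fun B u -> measurable_fun B L ->
  \int[mu]_(y in B) (Num.max (L y) 0)%:E =
    \int[mu]_(y in B) (Num.max (- L y) 0)%:E ->
  \int[mu]_(y in B) (Num.max (L y) 0)%:E < +oo ->
  a%:E * mu B <= \int[mu]_(y in B) u y ->
  (expR a)%:E * mu B <= \int[mu]_(y in B) expeR (u y - (L y)%:E).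
Proof.
move=> mB Boo mfu mL Lsym Loo au.
set H := \int[mu]_(y in B) expeR (u y - (L y)%:E).
have mh : measurable_fun B (fun y => expeR (u y - (L y)%:E)).
  apply: (measurableT_comp (@measurable_expeR R)).
  by apply: emeasurable_funB => //; exact/measurable_EFinP.
have mLp : measurable_fun B (fun y => (Num.max (L y) 0)%:E).
  by apply/measurable_EFinP; apply: measurable_maxr.
have mLn : measurable_fun B (fun y => (Num.max (- L y) 0)%:E).
  apply/measurable_EFinP; apply: measurable_maxr => //.
  by apply: measurableT_comp.
have mup : measurable_fun B u^\+ by apply: measurable_funepos.
have mun : measurable_fun B u^\- by apply: measurable_funeneg.
have mun0 : 0 <= \int[mu]_(y in B) u^\- y by apply: integral_ge0.
have mup0 : 0 <= \int[mu]_(y in B) u^\+ y by apply: integral_ge0.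
have P0 : 0 <= \int[mu]_(y in B) (Num.max (L y) 0)%:E.
  by apply: integral_ge0 => y _; rewrite lee_fin le_max lexx orbT.
have H0 : 0 <= H by apply: integral_ge0 => y _; exact: expeR_ge0.
have max0 (x : R) : 0 <= (Num.max x 0)%:E by rewrite lee_fin le_max lexx orbT.
have cstB0 (x : R) y : B y -> 0 <= cst (Num.max x 0)%:E y.
  by move=> _; exact: max0.
have mcst (x : \bar R) : measurable_fun B (cst x) by exact: measurable_cst.
pose f1 y := 1 + u^\+ y + (Num.max (- L y) 0)%:E + (Num.max (- a) 0)%:E.
pose f2 y := u^\- y + (Num.max (L y) 0)%:E + (Num.max a 0)%:E.
have f1E : \int[mu]_(y in B) f1 y = mu B + \int[mu]_(y in B) u^\+ y +
    \int[mu]_(y in B) (Num.max (- L y) 0)%:E + (Num.max (- a) 0)%:E * mu B.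
  rewrite ge0_integralD//; last 2 first.
  - by move=> y By; rewrite !adde_ge0.
  - by apply: emeasurable_funD => //; apply: emeasurable_funD.
  rewrite ge0_integralD//; last 2 first.
  - by move=> y By; rewrite !adde_ge0.
  - by apply: emeasurable_funD.
  by rewrite ge0_integralD// !integral_cst// mul1e.
have f2E : \int[mu]_(y in B) f2 y = \int[mu]_(y in B) u^\- y +
    \int[mu]_(y in B) (Num.max (L y) 0)%:E + (Num.max a 0)%:E * mu B.
  rewrite ge0_integralD//; last 2 first.
  - by move=> y By; rewrite !adde_ge0.
  - by apply: emeasurable_funD.
  by rewrite ge0_integralD// !integral_cst//.
have mf1 : measurable_fun B f1 by do 3 apply: emeasurable_funD => //.
have mf2 : measurable_fun B f2 by do 2 apply: emeasurable_funD => //.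
have f10 y : B y -> 0 <= f1 y by move=> By; rewrite !adde_ge0.
have f20 y : B y -> 0 <= f2 y by move=> By; rewrite !adde_ge0.
have : (expR a)%:E * \int[mu]_(y in B) f1 y <=
       H + (expR a)%:E * \int[mu]_(y in B) f2 y.
  rewrite -!ge0_integralZl_EFin ?expR_ge0// -ge0_integralD//; last 3 first.
  - by move=> y _; exact: expeR_ge0.
  - by move=> y By; rewrite mule_ge0 ?f20// lee_fin expR_ge0.
  - by apply: emeasurable_funM.
  apply: ge0_le_integral => //.
  - by move=> y By; rewrite mule_ge0 ?f10// lee_fin expR_ge0.
  - by apply: emeasurable_funM.
  - by apply: emeasurable_funD => //; apply: emeasurable_funM.
  - by move=> y By; rewrite /f1 /f2 funeposE funenegE; exact: expeR_tangent.
rewrite f1E f2E -Lsym.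
have [m mBE] : exists m, mu B = m%:E.
  by exists (fine (mu B)); rewrite fineK// ge0_fin_numE// measure_ge0.
(* The negative part of u has a finite integral by [au]. The remaining cases
   are whether the integrals of the positive part of u and of the exponential
   are finite. *)
move: au; rewrite mBE integralE; move: mun0 mup0 P0 H0 Loo.
case: (\int[mu]_(y in B) (Num.max (L y) 0)%:E) => [p| |]//.
case: (\int[mu]_(y in B) u^\- y) => [un| |]//;
  case: (\int[mu]_(y in B) u^\+ y) => [up| |]// _ _ _; case: H => [I| |]// _ _.
- rewrite -!(EFinD, EFinM, EFinN) !lee_fin => amu.
  have : (0 <= expR a * (up - un - a * m))%R.
    by rewrite mulr_ge0 ?expR_ge0 ?subr_ge0.
  have -> : (Num.max a 0 = a + Num.max (- a) 0)%R.
    by rewrite !maxEle; do 2 case: ifPn; lra.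
  by set E := expR a; lra.
- by move=> _ _; rewrite leey.
- by move=> _; rewrite addey// !addye// gt0_muley ?lte_fin ?expR_gt0//.
- by move=> _ _; rewrite leey.
Qed.

(** With [A = {(y, t) | 0 < t < g y}], Tonelli's theorem exhibits the integral
    of [h g] as the integral over [t > 0] of the integral of [h] over the
    superlevel set [{y | t < g y}], and likewise for [k]. *)
Lemma layer_cake_le (mu : {sigma_finite_measure set T -> \bar R}) (g : T -> R)
    (h k : T -> \bar R) :
  measurable_fun setT g -> measurable_fun setT h -> measurable_fun setT k ->
  (forall y, 0 <= g y)%R -> (forall y, 0 <= h y) -> (forall y, 0 <= k y) ->
  (forall t, (0 < t)%R -> \int[mu]_(y in [set y | t < g y]%R) k y <=
                    \int[mu]_(y in [set y | t < g y]%R) h y) ->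
  \int[mu]_y (k y * (g y)%:E) <= \int[mu]_y (h y * (g y)%:E).
Proof.
move=> mg mh mk g0 h0 k0 kh.
pose A : set (T * measurableTypeR R) := [set p | 0 < p.2 < g p.1]%R.
have mA : measurable A.
  have -> : A = [set p | 0 < p.2]%R `&` [set p | p.2 < g p.1]%R.
    by apply/seteqP; split=> p /=; [move=> /andP|move=> ?; apply/andP].
  have mg1 : measurable_fun [set: T * measurableTypeR R] (fun p => g p.1).
    exact: measurableT_comp.
  have m2 : measurable_fun [set: T * measurableTypeR R] (fun p => p.2 : R).
    exact: measurable_snd.
  apply: measurableI.
    have /(@emeasurable_fun_o_infty _ _ _ _ _ measurableT)/(_ 0) :
      measurable_fun setT (fun p : T * measurableTypeR R => (p.2)%:E).
      exact/measurable_EFinP.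
    by rewrite setTI; under eq_set do rewrite lte_fin.
  have /(@emeasurable_fun_o_infty _ _ _ _ _ measurableT)/(_ 0) :
    measurable_fun setT (fun p : T * measurableTypeR R => (g p.1 - p.2)%:E).
    by apply/measurable_EFinP; exact: measurable_funB.
  by rewrite setTI; under eq_set do rewrite lte_fin subr_gt0.
pose ph (f : T -> \bar R) (p : T * measurableTypeR R) := f p.1 * (\1_A p)%:E.
have mph f : measurable_fun setT f -> measurable_fun setT (ph f).
  move=> mf; apply: emeasurable_funM; first exact: measurableT_comp.
  by apply/measurable_EFinP; exact: measurable_indic.
have ph0 f : (forall y, 0 <= f y) -> forall p, 0 <= ph f p.
  by move=> f0 p; rewrite mule_ge0// lee_fin indicE.
have cake f : measurable_fun setT f -> (forall y, 0 <= f y) ->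
    \int[mu]_y (f y * (g y)%:E) =
    \int[lebesgue_measure]_t \int[mu]_y ph f (y, t).
  move=> mf f0; rewrite -(fubini_tonelli (ph f))//; [|exact: mph|exact: ph0].
  apply: eq_integral => y _.
  have AyE (t : measurableTypeR R) :
      \1_A (y, t) = \1_(`]0%R, g y[%classic : set (measurableTypeR R)) t :> R.
    by rewrite !indicE; congr (_%:R); apply/idP/idP; rewrite !inE /= in_itv.
  rewrite /ph/= ge0_integralZl//; last first.
    under eq_fun do rewrite AyE.
    by apply/measurable_EFinP; exact: measurable_indic.
  congr (_ * _); under eq_integral do rewrite AyE.
  rewrite integral_indic// setIT; apply/esym.
  apply: etrans (lebesgue_measure_itv `]0%R, g y[) _; rewrite /= lte_fin.
  case: ltP => gy0; first by rewrite oppr0 adde0.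
  by rewrite (_ : g y = 0%R)//; apply/le_anti/andP.
rewrite !cake//; apply: ge0_le_integral => //.
- by move=> t _; apply: integral_ge0 => y _; exact: (ph0 k).
- apply: (measurable_fun_fubini_tonelli_G (ph k)); [exact: mph|exact: ph0].
- apply: (measurable_fun_fubini_tonelli_G (ph h)); [exact: mph|exact: ph0].
move=> t _; have [t0|t0] := ltP 0%R t; last first.
  rewrite !integral0_eq// => y _;
    by rewrite /ph indicE memNset ?mule0// /A /= ltNge t0.
have phE f : \int[mu]_y ph f (y, t) = \int[mu]_(y in [set y | t < g y]%R) f y.
  rewrite [RHS]integral_mkcond; apply: eq_integral => y _.
  rewrite /ph patchE indicE /=; have [tg|tg] := ltP t (g y).
    by rewrite !mem_set ?mule1//= /A /= t0.
  by rewrite !memNset ?mule0//= /A /= ?t0 ltNge tg.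
by rewrite !phE; exact: kh.
Qed.

End jensen_layer_cake.

(** * Euclidean balls and Gaussian integrals in R^n *)

Section euclidean.
Variables (R : realType) (n : nat).
Implicit Types x y b : 'rV[R]_n.

Definition dot x y : R := \sum_(i < n) x 0 i * y 0 i.

Lemma sqr_enorm x : enorm x ^+ 2 = \sum_(i < n) x 0 i ^+ 2.
Proof. by rewrite sqr_sqrtr// sumr_ge0// => i _; exact: sqr_ge0. Qed.

Lemma eballE x r : 0 < r -> eball x r = [set y | enorm (y - x) ^+ 2 < r ^+ 2].
Proof.
move=> r0; apply/seteqP.
by split=> y; rewrite /eball /= ltr_pXn2r ?nnegrE ?sqrtr_ge0 ?ltW.
Qed.

Lemma measurable_sqr_enormB x :
  measurable_fun [set: 'rV[R]_n] (fun y => enorm (y - x) ^+ 2).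
Proof.
under eq_fun do rewrite sqr_enorm.
apply: measurable_sum => i; apply: measurable_funX.
under eq_fun do rewrite !mxE.
by apply: measurable_funB => //; exact: measurable_coord.
Qed.

Lemma measurable_sqr_enorm :
  measurable_fun [set: 'rV[R]_n] (fun y => enorm y ^+ 2).
Proof. by have := measurable_sqr_enormB 0; under eq_fun do rewrite subr0. Qed.

Lemma measurable_gaussian (s : R) x :
  measurable_fun [set: 'rV[R]_n]
    (fun y => expR (- (s * enorm (y - x) ^+ 2 / 2))).
Proof.
apply: measurableT_comp => //; apply: measurableT_comp => //.
apply: measurable_funM => //; apply: measurable_funM => //.
exact: measurable_sqr_enormB.
Qed.

Lemma measurable_dotB b x :
  measurable_fun [set: 'rV[R]_n] (fun y => dot b (y - x)).
Proof.
apply: measurable_sum => i; apply: measurable_funM => //.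
under eq_fun do rewrite !mxE.
by apply: measurable_funB => //; exact: measurable_coord.
Qed.

Lemma measurable_eball x r : 0 < r -> measurable (eball x r).
Proof.
move=> r0; rewrite eballE//.
have /(@emeasurable_fun_infty_o _ _ _ _ _ measurableT)/(_ (r ^+ 2)%:E) :
    measurable_fun [set: 'rV[R]_n] (fun y => (enorm (y - x) ^+ 2)%:E).
  by apply/measurable_EFinP; exact: measurable_sqr_enormB.
by rewrite setTI; under eq_set do rewrite lte_fin.
Qed.

Lemma dot_young b y : dot b y <= (enorm b ^+ 2 + enorm y ^+ 2) / 2.
Proof.
rewrite !sqr_enorm -big_split/= mulr_suml; apply: ler_sum => i _.
by have := sqr_ge0 (b 0 i - y 0 i); lra.
Qed.

Lemma dotN b y : dot b (- y) = - dot b y.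
Proof. by rewrite -sumrN; apply: eq_bigr => i _; rewrite mxE mulrN. Qed.

Lemma enormN y : enorm (- y) = enorm y.
Proof. by congr Num.sqrt; apply: eq_bigr => i _; rewrite mxE sqrrN. Qed.

Lemma sqr_enorm_expand x y :
  enorm y ^+ 2 = enorm x ^+ 2 + 2 * dot x (y - x) + enorm (y - x) ^+ 2.
Proof.
rewrite !sqr_enorm mulr_sumr -!big_split/=; apply: eq_bigr => i _.
by rewrite !mxE; ring.
Qed.

Lemma dotZl (a : R) x y : dot (a *: x) y = a * dot x y.
Proof. by rewrite mulr_sumr; apply: eq_bigr => i _; rewrite mxE mulrA. Qed.

Lemma superlevel_gaussian (s : R) x t : 0 < s -> 0 < t ->
  [set y | t < expR (- (s * enorm (y - x) ^+ 2 / 2))] = set0 \/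
  exists2 r, 0 < r &
    [set y | t < expR (- (s * enorm (y - x) ^+ 2 / 2))] = eball x r.
Proof.
move=> s0 t0; have [t1|t1] := leP 1 t; [left|right].
  apply/seteqP; split=> // y /=; apply/negP; rewrite -leNgt (le_trans _ t1)//.
  by rewrite -[leRHS]expR0 ler_expR oppr_le0 divr_ge0// mulr_ge0 ?sqr_ge0 ?ltW.
have lt0 : ln t < 0 by rewrite ln_lt0// t0.
have rho0 : 0 < - (2 * ln t / s).
  by rewrite oppr_gt0 pmulr_llt0 ?invr_gt0// pmulr_rlt0.
exists (Num.sqrt (- (2 * ln t / s))); first by rewrite sqrtr_gt0.
rewrite eballE ?sqrtr_gt0// sqr_sqrtr ?ltW//; apply/seteqP.
have E y : (t < expR (- (s * enorm (y - x) ^+ 2 / 2))) =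
           (enorm (y - x) ^+ 2 < - (2 * ln t / s)).
  rewrite -[t in LHS](lnK t0) ltr_expR -[in RHS]mulNr [RHS]ltr_pdivlMr//.
  by apply/idP/idP; lra.
by split=> y /=; rewrite E.
Qed.

Local Open Scope ereal_scope.

Lemma integral_reflection_rV x (F : 'rV[R]_n -> \bar R) :
  measurable_fun [set: 'rV[R]_n] F -> (forall y, 0 <= F y) ->
  \int[lebesgue_rV R n]_y F (x *+ 2 - y)%R = \int[lebesgue_rV R n]_y F y.
Proof.
move=> mF F0.
rewrite -[RHS](integral_product_measure_rV_map
  (phi := fun i t => x 0%R i *+ 2 - t)%R)//.
- by apply: eq_integral => y _; congr F; apply/rowP => i; rewrite !mxE mulr2n.
- by move=> i; exact: measurable_reflection.
- by move=> i G mG G0; exact: ge0_integral_reflection.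
Qed.

Lemma expR_enorm_prod s x y :
  expR (- (s * enorm (y - x) ^+ 2 / 2)) =
  (\prod_(i < n) expR (- (s * (y 0 i - x 0 i) ^+ 2 / 2)))%R :> R.
Proof.
rewrite -expR_sum; congr expR; rewrite sqr_enorm mulr_sumr mulr_suml -sumrN.
by apply: eq_bigr => i _; rewrite !mxE.
Qed.

Lemma integral_gaussian_rV s x : (0 < s)%R ->
  \int[lebesgue_rV R n]_y (expR (- (s * enorm (y - x) ^+ 2 / 2)))%:E =
  (Num.sqrt (s^-1 * pi *+ 2) ^+ n)%:E.
Proof.
move=> s0; under eq_integral do rewrite expR_enorm_prod.
rewrite (integral_product_measure_rV_prod
  (g := fun i t => expR (- (s * (t - x 0%R i) ^+ 2 / 2)))
  (c := fun=> Num.sqrt (s^-1 * pi *+ 2)))//.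
- by rewrite prodr_const card_ord.
- move=> i; apply: measurableT_comp => //; apply: measurableT_comp => //.
  apply: measurable_funM => //; apply: measurable_funM => //.
  by apply: measurable_funX; exact: measurable_funB.
- by move=> i; exact: integral_gaussian.
Qed.

Lemma gaussian_rV_lebesgue (F : 'rV[R]_n -> \bar R) :
  measurable_fun [set: 'rV[R]_n] F -> (forall y, 0 <= F y) ->
  \int[gaussian_rV R n]_y F y =
  (Num.sqrt (pi *+ 2) ^- n)%:E *
    \int[lebesgue_rV R n]_y ((expR (- (enorm y ^+ 2 / 2)))%:E * F y).
Proof.
move=> mF F0.
rewrite /gaussian_rV (integral_product_measure_rV_density
  (mu := lebesgue_measure)
  (g := normal_pdf 0 1))//; last 3 first.
- exact: measurable_normal_pdf.
- by move=> t; exact: normal_pdf_ge0.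
- by move=> G mG G0; exact: integral_normal_prob.
rewrite -ge0_integralZl_EFin//; last 2 first.
- by move=> y _; rewrite mule_ge0// lee_fin expR_ge0.
- apply: emeasurable_funM => //; apply/measurable_EFinP.
  apply: measurableT_comp => //; apply: measurableT_comp => //.
  by apply: measurable_funM => //; exact: measurable_sqr_enorm.
apply: eq_integral => y _; rewrite muleA -EFinM; congr (_%:E * _).
have := expR_enorm_prod 1 0%R y; rewrite subr0 mul1r => ->.
under eq_bigr do rewrite normal_pdfE ?oner_neq0//.
rewrite big_split/= prodr_const card_ord /normal_peak expr1n mul1r exprVn.
congr (_ * _)%R; apply: eq_bigr => i _.
by rewrite /normal_fun mxE expr1n; congr expR; field.
Qed.

(** The indicator of a ball is dominated by a multiple of a Gaussian. *)
Lemma lebesgue_eball_lty x r : (0 < r)%R -> lebesgue_rV R n (eball x r) < +oo.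
Proof.
move=> r0; have mB := measurable_eball x r0.
rewrite -[X in X < _]mul1e -integral_cst//.
pose w y : R := expR (- (1 * enorm (y - x) ^+ 2 / 2)).
have mw : measurable_fun [set: 'rV[R]_n] w by exact: measurable_gaussian.
apply: (@le_lt_trans _ _ (\int[lebesgue_rV R n]_(y in eball x r)
    (expR (r ^+ 2 / 2) * w y)%:E)).
  apply: ge0_le_integral => //.
  - apply/measurable_EFinP; apply: measurable_funM => //.
    exact: measurable_funTS.
  - move=> y; rewrite eballE//= => yB.
    by rewrite lee_fin -expRD -[leLHS]expR0 ler_expR; lra.
apply: (@le_lt_trans _ _
    (\int[lebesgue_rV R n]_y (expR (r ^+ 2 / 2) * w y)%:E)).
  apply: ge0_subset_integral => //.
  - by apply/measurable_EFinP; exact: measurable_funM.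
  - by move=> y _; rewrite lee_fin mulr_ge0 ?expR_ge0.
under eq_integral do rewrite EFinM.
rewrite ge0_integralZl_EFin ?expR_ge0//; last 2 first.
- by move=> y _; rewrite lee_fin expR_ge0.
- exact/measurable_EFinP.
by rewrite integral_gaussian_rV// -EFinM ltry.
Qed.

(** The reflection in [x] preserves the ball and changes the sign of the linear
    form. *)
Lemma integral_dot_eball b x r : (0 < r)%R ->
  \int[lebesgue_rV R n]_(y in eball x r) (Num.max (dot b (y - x)) 0)%:E =
  \int[lebesgue_rV R n]_(y in eball x r) (Num.max (- dot b (y - x)) 0)%:E.
Proof.
move=> r0; have mB := measurable_eball x r0.
rewrite integral_mkcond [RHS]integral_mkcond.
rewrite -[LHS](integral_reflection_rV x); last 2 first.
- apply/(measurable_restrictT _ mB); apply: measurable_funTS.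
  apply/measurable_EFinP; apply: measurable_maxr => //; exact: measurable_dotB.
- move=> y; apply: erestrict_ge0 => z _.
  by rewrite lee_fin le_max lexx orbT.
apply: eq_integral => y _; rewrite !patchE.
have reflE : (x *+ 2 - y - x = - (y - x))%R.
  by rewrite mulr2n opprB addrAC addrK.
have -> : ((x *+ 2 - y)%R \in eball x r) = (y \in eball x r).
  by apply/idP/idP; rewrite !inE /eball/= reflE enormN.
by rewrite reflE dotN.
Qed.

Lemma integral_dot_eball_lty b x r : (0 < r)%R ->
  \int[lebesgue_rV R n]_(y in eball x r) (Num.max (dot b (y - x)) 0)%:E < +oo.
Proof.
move=> r0; have mB := measurable_eball x r0.
apply: (@le_lt_trans _ _ (\int[lebesgue_rV R n]_(y in eball x r)
    (cst ((enorm b ^+ 2 + r ^+ 2) / 2)%:E y))).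
  apply: ge0_le_integral => //.
  - by move=> y _; rewrite lee_fin le_max lexx orbT.
  - apply/measurable_EFinP; apply: measurable_maxr => //.
    apply: measurable_funTS; exact: measurable_dotB.
  - move=> y; rewrite eballE//= => yB.
    rewrite lee_fin ge_max; have := dot_young b (y - x).
    have := sqr_ge0 (enorm b); have := sqr_ge0 (enorm (y - x)).
    by move: yB; lra.
rewrite integral_cst//= lte_mul_pinfty ?lebesgue_eball_lty//.
by rewrite lee_fin divr_ge0// addr_ge0 ?sqr_ge0.
Qed.

(** The form [<b, . - x>] has mean zero on the ball, so the sub-mean value
    property of [u] at [x] is the hypothesis of Jensen's inequality for
    [u - <b, . - x>]. *)
Lemma exp_subharmonic_tilt (u : 'rV[R]_n -> \bar R) b x r (a : R) :
  subharmonic u -> u x = a%:E -> (0 < r)%R ->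
  (expR a)%:E * lebesgue_rV R n (eball x r) <=
  \int[lebesgue_rV R n]_(y in eball x r) expeR (u y - (dot b (y - x))%:E).
Proof.
move=> [_ usc subm] ua r0; have mB := measurable_eball x r0.
have := subm x r r0.
have [m mE] : exists m, lebesgue_rV R n (eball x r) = m%:E.
  exists (fine (lebesgue_rV R n (eball x r))).
  by rewrite fineK// ge0_fin_numE// lebesgue_eball_lty.
have m0 : (0 <= m)%R by rewrite -lee_fin -mE.
have [m00|mneq0] := eqVneq m 0%R.
  (* The inverse of zero is zero: the mean carries no information here. *)
  by rewrite mE m00 mule0 => _; apply: integral_ge0 => y _; exact: expeR_ge0.
have mgt0 : (0 < m)%R by rewrite lt_neqAle eq_sym mneq0.
rewrite ua mE /= lee_pdivlMl// muleC -mE => au.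
apply: expR_mean_le => //.
- exact: lebesgue_eball_lty.
- by apply: measurable_funTS; exact: upper_semicontinuous_measurable.
- by apply: measurable_funTS; exact: measurable_dotB.
- exact: integral_dot_eball.
- exact: integral_dot_eball_lty.
Qed.

Lemma log_subharmonic_exp (beta : R) (f : 'rV[R]_n -> R) y : (0 <= f y)%R ->
  expeR (lne (f y)%:E - (- beta * (enorm y ^+ 2 / 2))%:E) =
  (f y * expR (beta * (enorm y ^+ 2 / 2)))%:E.
Proof.
move=> f0; rewrite -EFinN expeRD lneK; last by rewrite in_itv/= leey lee_fin f0.
by rewrite /= mulNr opprK.
Qed.

End euclidean.

(** * The pointwise bound *)

Theorem theorem1p16 (R : realType) (n : nat) (beta : R) (f : 'rV[R]_n -> R) :
  0 <= beta ->
  log_subharmonic (- beta) f ->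
  (\int[gaussian_rV R n]_x (f x)%:E = 1)%E ->
  forall x : 'rV[R]_n,
    f x <= (beta + 1) `^ (n%:R / 2) * expR (enorm x ^+ 2 / 2).
Proof.
move=> beta0 [f0 fsub] f1 x.
have [fx0|fx0] := leP (f x) 0.
  by rewrite (le_trans fx0)// mulr_ge0 ?powR_ge0 ?expR_ge0.
set u := (fun y => _) in fsub.
pose s := beta + 1.
have s0 : 0 < s by rewrite ltr_wpDl.
have uE y : expeR (u y) = (f y * expR (beta * (enorm y ^+ 2 / 2)))%:E.
  exact: log_subharmonic_exp.
have mu : measurable_fun [set: 'rV[R]_n] u.
  by case: fsub => _ usc _; exact: upper_semicontinuous_measurable.
have mq := measurable_sqr_enorm (R := R) (n := n).
have mexp (c : R) :
    measurable_fun [set: 'rV[R]_n] (fun y => expR (c * (enorm y ^+ 2 / 2))).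
  apply: measurableT_comp => //; apply: measurable_funM => //.
  exact: measurable_funM.
have mf : measurable_fun [set: 'rV[R]_n] (fun y => (f y)%:E).
  have -> : (fun y => (f y)%:E) =
      (fun y => expeR (u y) * (expR (- beta * (enorm y ^+ 2 / 2)))%:E)%E.
    apply/funext => y; rewrite uE -EFinM -mulrA -expRD mulNr subrr expR0.
    by rewrite mulr1.
  apply: emeasurable_funM; last exact/measurable_EFinP.
  by apply: measurableT_comp => //; exact: measurable_expeR.
(* [h] is the exponential of [u] tilted by the linear form that [s |y|^2 / 2]
   leaves when it is centred at [x]. *)
pose g y := expR (- (s * enorm (y - x) ^+ 2 / 2)).
pose h y := expeR (u y - (dot (s *: x) (y - x))%:E)%E.
pose a := ln (f x) + beta * (enorm x ^+ 2 / 2).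
have ua : u x = a%:E.
  by rewrite /u lne_EFin// -EFinB mulNr opprK.
have mg : measurable_fun [set: 'rV[R]_n] g by exact: measurable_gaussian.
have mh : measurable_fun [set: 'rV[R]_n] h.
  apply: measurableT_comp; first exact: measurable_expeR.
  apply: emeasurable_funB => //; apply/measurable_EFinP.
  exact: measurable_dotB.
have cake : (\int[lebesgue_rV R n]_y ((expR a)%:E * (g y)%:E) <=
             \int[lebesgue_rV R n]_y (h y * (g y)%:E))%E.
  apply: (layer_cake_le (k := cst (expR a)%:E)) => //.
  - by move=> y; exact: expR_ge0.
  - by move=> y; exact: expeR_ge0.
  - by move=> y; rewrite lee_fin expR_ge0.
  move=> t t0; have [->|[r r0 ->]] := superlevel_gaussian x s0 t0.
    by rewrite !integral_set0.
  rewrite integral_cst//; last exact: measurable_eball.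
  exact: exp_subharmonic_tilt.
have hgE y : (h y * (g y)%:E)%E = ((expR (s * (enorm x ^+ 2 / 2)))%:E *
    ((expR (- (enorm y ^+ 2 / 2)))%:E * (f y)%:E))%E.
  rewrite /h /g -EFinN expeRD uE /= -!EFinM; congr EFin.
  rewrite [RHS]mulrA -[in RHS]expRD [RHS]mulrC -2![LHS]mulrA -2![in LHS]expRD.
  congr (_ * expR _); rewrite dotZl (sqr_enorm_expand x y) /s.
  by field.
pose c : R := Num.sqrt (pi *+ 2).
have c0 : 0 < c by rewrite sqrtr_gt0 mulrn_wgt0// pi_gt0.
move: f1; rewrite gaussian_rV_lebesgue//.
move: cake; under [X in (_ <= X)%E]eq_integral do rewrite hgE.
have gauss0 y : (0 <= (expR (- (enorm y ^+ 2 / 2)))%:E * (f y)%:E)%E.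
  by rewrite mule_ge0// lee_fin// expR_ge0.
have mgauss : measurable_fun [set: 'rV[R]_n]
    (fun y => (expR (- (enorm y ^+ 2 / 2)))%:E * (f y)%:E)%E.
  apply: emeasurable_funM => //; apply/measurable_EFinP.
  by under eq_fun do rewrite -mulN1r; exact: mexp.
rewrite !ge0_integralZl_EFin ?expR_ge0//; last 2 first.
- by move=> y _; rewrite lee_fin expR_ge0.
- exact/measurable_EFinP.
rewrite integral_gaussian_rV//.
have cn0 : 0 < c ^- n by rewrite invr_gt0 exprn_gt0.
case: (\int[lebesgue_rV R n]_x _)%E => [I| |]; last 2 first.
- by move=> _; rewrite gt0_muley ?lte_fin.
- by move=> _; rewrite gt0_muleNy ?lte_fin.
rewrite -!EFinM lee_fin => cake [] cI.
have IE : I = c ^+ n by rewrite -[I](mulKf (lt0r_neq0 cn0)) cI invrK mulr1.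
have powE : s `^ (n%:R / 2) = Num.sqrt s ^+ n.
  by rewrite mulrC powRrM powR12_sqrt ?ltW// powR_mulrn// sqrtr_ge0.
rewrite -/s powE; move: cake; rewrite IE.
rewrite -mulrnAr sqrtrM ?invr_ge0 ?(ltW s0)// -/c exprMn /a expRD lnK//.
have -> : s * (enorm x ^+ 2 / 2) = beta * (enorm x ^+ 2 / 2) + enorm x ^+ 2 / 2.
  by rewrite /s; ring.
rewrite expRD (mulrA _ _ (c ^+ n)) ler_pM2r ?exprn_gt0//.
rewrite sqrtrV ?(ltW s0)// exprVn ler_pdivrMr ?exprn_gt0 ?sqrtr_gt0//.
rewrite mulrC -!mulrA ler_pM2l ?expR_gt0//.
by rewrite mulrC.
Qed.
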